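(* Consider a time-homogeneous discrete-time Markov chain with three states $1,2,3$ and one-step transition probabilities $p_{ij}$, $i,j\in\{1,2,3\}$. Let $\psi_{13}(z)$ be the probability generating function of the first passage time $X_{13}$ from state $1$ to state $3$. Then $$\psi_{13}(z)=\frac{p_{13}z+(p_{12}p_{23}-p_{13}p_{22})z^2}{1-(p_{11}+p_{22})z+(p_{11}p_{22}-p_{12}p_{21})z^2}.$$
   Context: Let $(S_m)_{m\ge 0}$ be the Markov chain. The first passage time $X_{13}$ is the number of steps needed to move from state $1$ to state $3$ for the first time, i.e. given $S_0=1$, $X_{13}=\min\{m\ge 1: S_m=3\}$ (with $X_{13}=\infty$ if there is no such $m$). The first passage probabilities are $f_{13}(k)=P(X_{13}=k)$ for $k=1,2,\dots$. The probability generating function of $X_{13}$ is $\psi_{13}(z)=\sum_{k=1}^{\infty} f_{13}(k)z^k$; the identity is understood as an identity of formal power series in $z$ (the denominator has constant term $1$, hence is invertible as a formal power series), equivalently for all real $z$ with $|z|<1$. *)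

(* Defs.v *)
From HB Require Import structures.
From mathcomp Require Import all_boot all_order all_algebra.
From mathcomp Require Import all_classical all_reals all_analysis.
Import Order.TTheory GRing.Theory Num.Theory.
Import numFieldNormedType.Exports.

Set Implicit Arguments.
Unset Strict Implicit.
Unset Printing Implicit Defensive.

Local Open Scope classical_set_scope.
Local Open Scope ring_scope.

Definition stochastic (R : realType) (n : nat) (p : 'M[R]_n) : Prop :=
  (forall i j, 0 <= p i j) /\ (forall i, \sum_j p i j = 1).

(* P(A | B); it is 0 (a junk value) when P(B) = 0. *)
Definition cprob (d : measure_display) (T : measurableType d) (R : realType)
    (P : probability T R) (A B : set T) : R :=
  fine (P (A `&` B)) / fine (P B).

(* S 0, S 1, ... are random variables on (T, P) with values in the discrete
   space 'I_n. The Markov property is required for every history of positive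
   probability; time-homogeneity is the independence of p from m. The initial
   distribution is unconstrained. *)
Definition markov_chain (d : measure_display) (T : measurableType d)
    (R : realType) (P : probability T R) (n : nat)
    (p : 'M[R]_n) (S : nat -> T -> 'I_n) : Prop :=
  [/\ stochastic p,
      forall m (A : set 'I_n), measurable (S m @^-1` A) &
      forall m (s : nat -> 'I_n) (j : 'I_n),
        let history := [set w | forall k, (k <= m)%N -> S k w = s k] in
        P history != 0%E ->
        cprob P [set w | S m.+1 w = j] history = p (s m) j].

(* min {m >= 1 | S_m = j}, where None stands for infinity. *)
Definition first_passage_time (T : Type) (n : nat) (S : nat -> T -> 'I_n)
    (j : 'I_n) (w : T) : option nat :=
  match pselect (exists m, (0 < m)%N && (S m w == j)) with
  | left e => Some (ex_minn e)
  | right _ => None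
  end.

Definition first_passage_prob (d : measure_display) (T : measurableType d)
    (R : realType) (P : probability T R) (n : nat) (S : nat -> T -> 'I_n)
    (i j : 'I_n) (k : nat) : R :=
  cprob P [set w | first_passage_time S j w = Some k] [set w | S 0%N w = i].

Definition pgf_partial (R : realType) (f : nat -> R) (z : R) : R^nat :=
  fun N => \sum_(1 <= k < N.+1) f k * z ^+ k.

(* A limn is a meaningful value only if pgf_partial f z converges. *)
Definition pgf (R : realType) (f : nat -> R) (z : R) : R :=
  limn (pgf_partial f z).

(* The states 1, 2, 3 are the ordinals 0, 1, 2. *)
Definition st1 : 'I_3 := @Ordinal 3 0 isT.
Definition st2 : 'I_3 := @Ordinal 3 1 isT.
Definition st3 : 'I_3 := @Ordinal 3 2 isT.

(* Main.v *)
Require Import Defs.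
From HB Require Import structures.
From mathcomp Require Import all_boot all_order all_algebra.
From mathcomp Require Import all_classical all_reals all_analysis.
From mathcomp Require Import ring lra.
Import Order.TTheory GRing.Theory Num.Theory.
Import numFieldNormedType.Exports.

(** Let [u k] and [v k] be the probabilities of being in state 1, resp. 2, at
    time [k] without having visited state 3. The Markov property makes
    [(u, v)] evolve linearly by the restriction of [p] to the states 1 and 2,
    and [f13 k.+1 = u k * p13 + v k * p23]. Solving the 2 x 2 system for the
    truncated generating functions gives [den * F_N = num + O(z ^ N)], since
    [u] and [v] are bounded, and the limit is the claimed quotient. *)

Set Implicit Arguments.
Unset Strict Implicit.
Unset Printing Implicit Defensive.

Local Open Scope classical_set_scope.
Local Open Scope ring_scope.

(** * Finite partitions and events decided by the past *)

Lemma measurable_finite_partition (d : measure_display) (T : measurableType d)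
    (F : finType) (X : T -> F) (A : set T) :
  (forall x, measurable (A `&` [set w | X w = x])) -> measurable A.
Proof.
move=> mAX.
have -> : A = \bigcup_x (A `&` [set w | X w = x]).
  apply/seteqP; split=> [w Aw|w [x _ []]//].
  by exists (X w).
by apply: fin_bigcup_measurable => //; exact: finite_finset.
Qed.

Lemma probability_partition (d : measure_display) (T : measurableType d)
    (R : realType) (P : probability T R) (F : finType) (X : T -> F)
    (A : set T) :
  (forall x, measurable (A `&` [set w | X w = x])) ->
  fine (P A) = \sum_x fine (P (A `&` [set w | X w = x])).
Proof.
move=> mAX.
have {1}-> : A = \bigcup_x (A `&` [set w | X w = x]).
  apply/seteqP; split=> [w Aw|w [x _ []]//].
  by exists (X w).
rewrite measure_fin_bigcup //; first last.
- by move=> x y _ _ [w [[_ <-] [_ <-]]].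
- exact: finite_finset.
rewrite sum_fine; last by move=> x _; apply: fin_num_measure.
congr fine; rewrite (fsbig_seq _ _ (index_enum_uniq F)).
by apply: eq_fsbigl; apply/seteqP; split=> x //= _; rewrite mem_index_enum.
Qed.

(** Membership in the sigma-algebra generated by [S 0], ..., [S m], expressed on paths: with
    finitely many states it has finitely many atoms, so invariance under agreement of paths
    suffices. *)
Definition past_measurable (T : Type) (n : nat) (S : nat -> T -> 'I_n) (m : nat)
    (B : set T) : Prop :=
  forall w w', (forall k, (k <= m)%N -> S k w = S k w') -> B w -> B w'.

Lemma past_measurableI (T : Type) (n : nat) (S : nat -> T -> 'I_n) (m : nat)
    (A B : set T) :
  past_measurable S m A -> past_measurable S m B ->
  past_measurable S m (A `&` B).
Proof. by move=> hA hB w w' e [/(hA _ _ e) ? /(hB _ _ e)]. Qed.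

Lemma past_measurable_state (T : Type) (n : nat) (S : nat -> T -> 'I_n)
    (m : nat) (j : 'I_n) : past_measurable S m [set w | S m w = j].
Proof. by move=> w w' /(_ m (leqnn m)) /= <-. Qed.
Arguments past_measurable_state {T n} S m j.

Lemma first_passage_timeP (T : Type) (n : nat) (S : nat -> T -> 'I_n)
    (j : 'I_n) (w : T) (m : nat) :
  first_passage_time S j w = Some m.+1 <->
  (forall k, (0 < k <= m)%N -> S k w != j) /\ S m.+1 w = j.
Proof.
rewrite /first_passage_time; case: pselect => [e|ne]; split=> //.
- case: ex_minnP => m' /andP[_ /eqP wj] min [m'E]; subst m'.
  split=> // k /andP[k0 km]; apply/eqP => kj.
  by have := min k; rewrite k0 kj eqxx => /(_ isT); rewrite ltnNge km.
- move=> [hw wj]; congr Some; case: ex_minnP => k /andP[k0 /eqP kj] min.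
  apply/eqP; rewrite eqn_leq min ?wj ?eqxx //= ltnNge; apply/negP => km.
  by have := hw k; rewrite k0 km kj eqxx => /(_ isT).
- by move=> [_ wj]; case: ne; exists m.+1; rewrite wj eqxx.
Qed.

(** * Markov property for past events; taboo probabilities *)

Section MarkovChain.
Variables (d : measure_display) (T : measurableType d) (R : realType).
Variables (P : probability T R) (n : nat) (p : 'M[R]_n) (S : nat -> T -> 'I_n).
Hypothesis hS : markov_chain P p S.

Let hist (m : nat) (w : T) : {ffun 'I_m.+1 -> 'I_n} :=
  [ffun k : 'I_m.+1 => S k w].

(** Each fibre of [hist m] is an atom of the past, so it misses [B] or lies inside it. The second
    case has the shape of the histories in [markov_chain], with [inord] extending [x] to all of
    [nat]. *)
Let histE m (B : set T) (x : {ffun 'I_m.+1 -> 'I_n}) :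
  past_measurable S m B ->
  B `&` [set w | hist m w = x] = set0 \/
  B `&` [set w | hist m w = x]
    = [set w | forall k, (k <= m)%N -> S k w = x (inord k)].
Proof.
move=> hB.
have E : [set w | hist m w = x]
    = [set w | forall k, (k <= m)%N -> S k w = x (inord k)].
  apply/seteqP; split=> w /= h.
    by move=> k km; rewrite -h ffunE inordK.
  by apply/ffunP => k; rewrite ffunE h ?inord_val // -ltnS.
rewrite E; have [->|/set0P[w [Bw /= hw]]] := eqVneq (B `&` [set w | forall k,
    (k <= m)%N -> S k w = x (inord k)]) set0; first by left.
right; apply/seteqP; split=> w' /=; first by case.
move=> hw'; split=> //.
by apply: hB Bw => k km; rewrite hw ?hw'.
Qed.

Let measurable_hist m (s : nat -> 'I_n) :
  measurable [set w | forall k, (k <= m)%N -> S k w = s k].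
Proof.
have [_ mS _] := hS.
have -> : [set w | forall k, (k <= m)%N -> S k w = s k]
    = \bigcap_(k in [set k | (k <= m)%N]) (S k @^-1` [set s k]).
  by apply/seteqP; split=> w h k; apply: h.
by apply: bigcap_measurable => [|k _]; [exists 0%N|exact: mS].
Qed.

Lemma past_measurable_measurable m (B : set T) :
  past_measurable S m B -> measurable B.
Proof.
move=> hB; apply: (@measurable_finite_partition _ _ _ (hist m)) => x.
by have [->|->] := histE x hB.
Qed.

(** The defining property speaks of single full histories. The nonempty ones that make up [B] all
    end in [i], so they share the factor [p i j] and can be summed. *)
Lemma markov_past m (B : set T) (i j : 'I_n) :
  past_measurable S m B -> B `<=` [set w | S m w = i] ->
  fine (P (B `&` [set w | S m.+1 w = j])) = fine (P B) * p i j.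
Proof.
have [_ _ hM] := hS.
move=> hB BS.
have mj : measurable [set w | S m.+1 w = j].
  exact: past_measurable_measurable (past_measurable_state _ _ j).
rewrite !(@probability_partition _ _ _ P _ (hist m)); first last.
- move=> x; rewrite setIAC; have [->|->] := histE x hB.
    by rewrite set0I.
  by apply: measurableI => //; exact: measurable_hist.
- by move=> x; have [->|->] := histE x hB.
rewrite mulr_suml; apply: eq_bigr => x _.
rewrite setIAC; have [->|E] := histE x hB.
  by rewrite set0I measure0 mul0r.
rewrite E; set H := [set w | _].
have mH : measurable H by exact: measurable_hist.
(* Null histories escape the Markov hypothesis, but contribute 0 to both sides. *)
have [PH0|PH0] := eqVneq (P H) 0%E.
  rewrite PH0 mul0r; suff -> : P (H `&` [set w | S m.+1 w = j]) = 0%E by [].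
  by apply: (subset_measure0 _ mH) => //; exact: measurableI.
have fH : P H \is a fin_num by exact: fin_num_measure.
have := hM m (fun k => x (inord k)) j PH0.
(* A history of nonzero probability contains some path, which lies in [B] and so ends in [i]. *)
have -> : x (inord m) = i.
  have [w Hw] : H !=set0.
    by apply/set0P; apply: contra PH0 => /eqP ->; rewrite measure0.
  rewrite -(Hw m (leqnn m)); apply: BS.
  by have : H w by []; rewrite /H -E => -[].
rewrite /cprob setIC => <-; rewrite -/H.
by rewrite mulrC divfK // fine_eq0.
Qed.

Let start (i j : 'I_n) (m : nat) : set T :=
  [set w | S 0%N w = i /\ forall k, (0 < k <= m)%N -> S k w != j].

Let past_start i j m : past_measurable S m (start i j m).
Proof.
move=> w w' e [w0 hw]; split; first by rewrite -e.
by move=> k km; rewrite -e ?hw //; case/andP: km.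
Qed.

(** Chung's taboo probabilities. The taboo on [j] starts at time 1, just as [first_passage_time]
    ignores time 0. *)
Definition taboo_prob (i j : 'I_n) (m : nat) (l : 'I_n) : R :=
  cprob P [set w | (forall k, (0 < k <= m)%N -> S k w != j) /\ S m w = l]
    [set w | S 0%N w = i].

Let taboo_probE i j m l :
  taboo_prob i j m l = fine (P (start i j m `&` [set w | S m w = l]))
    / fine (P [set w | S 0%N w = i]).
Proof.
rewrite /taboo_prob /cprob; congr (fine (P _) / _).
by apply/seteqP; split=> w /=; rewrite /start /=; tauto.
Qed.

(** Time [m.+1] is left free of the taboo, so that one formula serves twice: [l != j] gives the next
    taboo probability, [l = j] the first passage at [m.+1]. *)
Let start_step i j m l :
  fine (P (start i j m `&` [set w | S m.+1 w = l]))
    / fine (P [set w | S 0%N w = i]) = \sum_k taboo_prob i j m k * p k l.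
Proof.
have pk k : past_measurable S m (start i j m `&` [set w | S m w = k]).
  exact: past_measurableI (@past_start i j m) (past_measurable_state _ _ k).
rewrite (@probability_partition _ _ _ P _ (S m)); last first.
  move=> k; rewrite setIAC; apply: measurableI.
    exact: past_measurable_measurable (pk k).
  exact: past_measurable_measurable (past_measurable_state _ _ l).
rewrite mulr_suml; apply: eq_bigr => k _.
rewrite setIAC (@markov_past _ _ k l (pk k)); last by move=> w [].
by rewrite taboo_probE mulrAC.
Qed.

Lemma taboo_probS (i j : 'I_n) (m : nat) (l : 'I_n) : l != j ->
  taboo_prob i j m.+1 l = \sum_k taboo_prob i j m k * p k l.
Proof.
move=> lj; rewrite taboo_probE -start_step; congr (fine (P _) / _).
apply/seteqP; split=> w [[w0 hw] /= wl]; split=> //; split=> // k.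
  by case/andP=> k0 km; rewrite hw // k0 leqW.
case/andP=> k0; rewrite leq_eqVlt => /predU1P[->|km]; first by rewrite wl.
by rewrite hw // k0.
Qed.

(** For [m > 0] the taboo itself excludes [j]; at [m = 0] it is not yet in force and [i != j] takes
    over. *)
Lemma taboo_prob_eq0 (i j : 'I_n) (m : nat) : i != j ->
  taboo_prob i j m j = 0.
Proof.
move=> ij; rewrite taboo_probE.
suff -> : start i j m `&` [set w | S m w = j] = set0.
  by rewrite measure0 mul0r.
apply/seteqP; split=> // w [[w0 hw] /= wj]; case: m wj hw => [wj _|m wj hw].
  by move: ij; rewrite -w0 wj eqxx.
by have := hw m.+1; rewrite leqnn wj eqxx => /(_ isT).
Qed.

Lemma taboo_prob0 (i j l : 'I_n) : P [set w | S 0%N w = i] != 0%E ->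
  taboo_prob i j 0 l = (l == i)%:R.
Proof.
move=> P0; rewrite taboo_probE.
have mi : measurable [set w | S 0%N w = i].
  exact: past_measurable_measurable (past_measurable_state _ _ i).
have [->|li] := eqVneq l i.
  have -> : start i j 0 `&` [set w | S 0%N w = i] = [set w | S 0%N w = i].
    by apply/seteqP; split=> w /= => [[]|w0] //; split=> //; split=> // -[].
  (* Positive probability of the start makes this quotient 1 rather than the junk value 0. *)
  by rewrite divff // fine_eq0 // fin_num_measure.
have -> : start i j 0 `&` [set w | S 0%N w = l] = set0.
  by apply/seteqP; split=> // w [[w0 _] /= wl]; move: li; rewrite -wl w0 eqxx.
by rewrite measure0 mul0r.
Qed.

Lemma first_passage_probS (i j : 'I_n) (m : nat) :
  first_passage_prob P S i j m.+1 = \sum_k taboo_prob i j m k * p k j.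
Proof.
rewrite -start_step /first_passage_prob /cprob; congr (fine (P _) / _).
apply/seteqP; split=> w /=.
  rewrite first_passage_timeP => -[[hw wj] w0]; split=> //; split=> //.
by case=> -[w0 hw] wj; rewrite first_passage_timeP.
Qed.

End MarkovChain.

Lemma pgf_den_neq0 (R : realFieldType) (a b c e z : R) :
  0 <= a -> 0 <= b -> 0 <= c -> 0 <= e -> a + b <= 1 -> c + e <= 1 ->
  `|z| < 1 -> 1 - (a + e) * z + (a * e - b * c) * z ^+ 2 != 0.
Proof.
move=> a0 b0 c0 e0 ab ce z1.
(* This is the determinant of [I - z Q] for the block [Q] with rows [(a, b)] and [(c, e)], strictly
   diagonally dominant when [|z| < 1]. Since [z ^+ 2] is the square of [|z|], the off-diagonal
   product can be compared factor by factor. *)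
have -> : 1 - (a + e) * z + (a * e - b * c) * z ^+ 2
  = (1 - a * z) * (1 - e * z) - (b * `|z|) * (c * `|z|).
  rewrite mulrACA -expr2 real_normK ?num_real //; ring.
have zn : - `|z| <= z <= `|z| by rewrite -ler_norml.
have z0 := normr_ge0 z.
have bz : b * `|z| < 1 - a * z by nra.
have cz : c * `|z| < 1 - e * z by nra.
by rewrite subr_eq0 gt_eqF // ltr_pM // mulr_ge0.
Qed.

(* The coefficients of [u N] and [v N] are [den] times the generating functions
   of the passage times to 3 from 1 and from 2: conditionally on not having
   reached 3, the chain restarts at time [N]. *)
Lemma pgf_partial_identity (R : comNzRingType) (p11 p12 p13 p21 p22 p23 z : R)
    (u v f : nat -> R) (N : nat) :
  u 0%N = 1 -> v 0%N = 0 ->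
  (forall k, u k.+1 = u k * p11 + v k * p21) ->
  (forall k, v k.+1 = u k * p12 + v k * p22) ->
  (forall k, f k.+1 = u k * p13 + v k * p23) ->
  (1 - (p11 + p22) * z + (p11 * p22 - p12 * p21) * z ^+ 2)
    * (\sum_(1 <= k < N.+1) f k * z ^+ k)
  = p13 * z + (p12 * p23 - p13 * p22) * z ^+ 2
    - z ^+ N * (u N * (p13 * z + (p12 * p23 - p13 * p22) * z ^+ 2)
                + v N * (p23 * z + (p21 * p13 - p23 * p11) * z ^+ 2)).
Proof.
move=> u0 v0 hu hv hf; elim: N => [|N IHN].
  by rewrite big_geq // u0 v0; ring.
(* The denominator times the new term is exactly the drop in the remainder, a polynomial identity
   once the recurrences are substituted. *)
rewrite big_nat_recr //= mulrDr IHN hf hu hv (exprS _ N); ring.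
Qed.

(** Convergence and [den != 0] belong to the conclusion because [limn] and division would otherwise
    return default values. *)
Theorem theorem2p2 (d : measure_display) (T : measurableType d) (R : realType)
    (P : probability T R) (p : 'M[R]_3) (S : nat -> T -> 'I_3)
    (hS : markov_chain P p S)
    (hS0 : P [set w | S 0%N w = st1] != 0%E)
    (z : R) (hz : `|z| < 1) :
  let f13 := first_passage_prob P S st1 st3 in
  let num := p st1 st3 * z
    + (p st1 st2 * p st2 st3 - p st1 st3 * p st2 st2) * z ^+ 2 in
  let den := 1 - (p st1 st1 + p st2 st2) * z
    + (p st1 st1 * p st2 st2 - p st1 st2 * p st2 st1) * z ^+ 2 in
  [/\ cvgn (pgf_partial f13 z), den != 0 & pgf f13 z = num / den].
Proof.
move=> f13 num den.
have [[p0 p1] _ _] := hS.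
have sum3 (g : 'I_3 -> R) : \sum_k g k = g st1 + g st2 + g st3.
  rewrite !big_ord_recl big_ord0 addr0 addrA.
  by congr (g _ + g _ + g _); apply: val_inj.
have row i : p i st1 + p i st2 <= 1.
  by rewrite -(p1 i) sum3 lerDl.
have den0 : den != 0 by apply: pgf_den_neq0.
pose u k := taboo_prob P S st1 st3 k st1.
pose v k := taboo_prob P S st1 st3 k st2.
have u0 : u 0%N = 1 by rewrite /u (taboo_prob0 hS) ?eqxx.
have v0 : v 0%N = 0 by rewrite /v (taboo_prob0 hS).
(* State 3 carries no mass under the taboo, which leaves a 2 x 2 system. *)
have sumE k j : \sum_l taboo_prob P S st1 st3 k l * p l j
    = u k * p st1 j + v k * p st2 j.
  by rewrite sum3 taboo_prob_eq0 // mul0r addr0.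
have uS k : u k.+1 = u k * p st1 st1 + v k * p st2 st1.
  by rewrite -sumE /u (taboo_probS hS).
have vS k : v k.+1 = u k * p st1 st2 + v k * p st2 st2.
  by rewrite -sumE /v (taboo_probS hS).
have fS k : f13 k.+1 = u k * p st1 st3 + v k * p st2 st3.
  by rewrite -sumE; apply: (first_passage_probS hS).
(* The block on states 1 and 2 is substochastic, so the total mass never exceeds 1. *)
have uv k : [/\ 0 <= u k, 0 <= v k & u k + v k <= 1].
  elim: k => [|k [hu hv huv]]; first by rewrite u0 v0 addr0 ler01 lexx.
  have := p0 st1 st1; have := p0 st1 st2; have := p0 st2 st1.
  have := p0 st2 st2; have := row st1; have := row st2.
  by rewrite uS vS; split; nra.
clearbody u v.
(* The numerator for passage from 2 to 3: [num] with states 1 and 2 exchanged. *)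
pose num2 := p st2 st3 * z
  + (p st2 st1 * p st1 st3 - p st2 st3 * p st1 st1) * z ^+ 2.
pose err N := z ^+ N * (u N * num + v N * num2).
have FE N : pgf_partial f13 z N = (num - err N) / den.
  apply: (mulfI den0); rewrite mulrCA divff // mulr1.
  exact: pgf_partial_identity.
have err0 : err N @[N --> \oo] --> 0.
  apply/norm_cvg0P.
  (* As [u N] and [v N] lie in [[0, 1]], the error is dominated by a geometric sequence. *)
  apply: (@squeeze_cvgr _ _ _ _ (fun=> 0)
    (fun N => `|z| ^+ N * (`|num| + `|num2|))).
  - apply: nearW => N; rewrite normr_ge0 /= normrM normrX.
    apply: ler_wpM2l; first exact: exprn_ge0.
    have [hu hv huv] := uv N.
    apply: (le_trans (ler_normD _ _)); rewrite (normrM (u N)) (normrM (v N)).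
    rewrite (ger0_norm hu) (ger0_norm hv).
    have [hu1 hv1] : u N <= 1 /\ v N <= 1 by split; lra.
    by apply: lerD; apply: ler_piMl.
  - exact: cvg_cst.
  - rewrite -[X in _ --> X](mul0r (`|num| + `|num2|)).
    by apply: cvgMl; apply: cvg_expr; rewrite normr_id.
have cvgF : pgf_partial f13 z @ \oo --> num / den.
  rewrite (funext FE) -[in X in _ --> X](subr0 num).
  by apply: cvgMl; apply: cvgB => //; exact: cvg_cst.
split=> //; first by apply/cvg_ex; exists (num / den).
exact: cvg_lim.
Qed.
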